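(* For every $\varepsilon>0$ there is a constant $C_\varepsilon>0$ such that for every prime power $q$ and all integers $n\ge 2$ and $1\le m\le n$ with $8\log n\ge m\ge(2+\varepsilon)\log_q n$, writing $u=n/m$ and $a=1$ if $m$ is even, $a=0$ if $m$ is odd, $$\left|\frac{\mathbb{P}(f_n\text{ is }m\text{-smooth})}{\mathbb{P}(\pi_n\text{ is }m\text{-smooth})}-1\right|\le C_\varepsilon\,\frac{u\,n^{\frac{1+a}{m}}}{q^{\lceil\frac{m+1}{2}\rceil}} .$$
   Context: $\log$ is the natural logarithm and $\log_q$ is the base-$q$ logarithm. $\pi_n$ is a uniformly random permutation in the symmetric group $S_n$. $f_n=f_{n,q}$ is a uniformly random element of the set of monic polynomials of degree $n$ over the finite field $\mathbb{F}_q$. A permutation is $m$-smooth if all its cycles have length at most $m$. A polynomial over $\mathbb{F}_q$ is $m$-smooth if all its irreducible factors have degree at most $m$. *)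

(* Defs.v *)
From mathcomp Require Import all_boot all_order perm all_algebra.
From mathcomp Require Import boolp reals exp.

Set Implicit Arguments.
Unset Strict Implicit.
Unset Printing Implicit Defensive.

Import Order.TTheory GRing.Theory Num.Theory.
Local Open Scope ring_scope.

(* The probability that a uniformly random element of the nonempty finite set
   [Omega] satisfies [P]. *)
Definition unif_prob (R : realType) (T : finType) (Omega : {set T})
    (P : T -> Prop) : R :=
  #|[set x in Omega | `[< P x >]]|%:R / #|Omega|%:R.

Definition perm_smooth (n m : nat) (s : 'S_n) : Prop :=
  forall C : {set 'I_n}, C \in porbits s -> (#|C| <= m)%N.

Definition poly_smooth (F : fieldType) (m : nat) (f : {poly F}) : Prop :=
  forall g : {poly F}, irreducible_poly g -> g %| f -> ((size g).-1 <= m)%N.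

Definition monic_polys (F : finFieldType) (n : nat) : {set {poly_n.+1 F}} :=
  [set f | (polyn f \is monic) && (size (polyn f) == n.+1)].

Definition prob_perm_smooth (R : realType) (n m : nat) : R :=
  unif_prob R [set: 'S_n] (fun s => perm_smooth m s).

Definition prob_poly_smooth (R : realType) (F : finFieldType) (n m : nat) : R :=
  unif_prob R (monic_polys F n) (fun f => poly_smooth m (polyn f)).

Definition logb (R : realType) (b x : R) : R := ln x / ln b.

(* Main.v *)
Require Import Defs.
From mathcomp Require Import all_boot all_order fingroup perm all_algebra.
From mathcomp Require Import boolp reals sequences exp.
From mathcomp Require Import ring lra zify.
Set Implicit Arguments.
Unset Strict Implicit.
Unset Printing Implicit Defensive.
Import Order.TTheory GRing.Theory Num.Theory.
Local Open Scope ring_scope.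

(** Write p(n) and b(n) for the probabilities that a permutation of n points
    and a monic polynomial of degree n are m-smooth. Both are coefficients of
    exponentials: p(n) = [z^n] exp(sum_(j <= m) z^j / j) and
    b(n) = [z^n] exp(sum_j w_j z^j / j), where
    w_j = q^-j sum_(d | j, d <= m) d pi(d) and pi(d) counts the monic
    irreducible polynomials of degree d. Such a coefficient sequence c is
    determined by c_0 = 1 and n c_n = sum_j w_j c_(n-j), and this recurrence is
    what the combinatorics provides: on the permutation side by looking at the
    cycle of one point ([prob_perm_smoothE]), on the polynomial side by counting
    the pairs (f, P^k) with P irreducible and P^k dividing f, each with weight
    deg P ([prob_poly_smoothE]).

    Since the d pi(d) with d dividing j add up to q^j, the weight w_j is exactly
    1 for j <= m. Hence the second exponential is the first one times
    exp(sum_(j > m) w_j z^j / j), which has nonnegative coefficients g_k and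
    g_0 = 1 ([expcD]), and
       b(n) / p(n) - 1 = sum_(1 <= k <= n) g_k p(n-k) / p(n) >= 0.

    The heart of the proof is the bound p(n-k) <= e n^(k/m) p(n)
    ([perm_density_shift]), which plays the part of a saddle point estimate at
    x = n^(1/m). It rests on the log-concavity of p, an instance of a theorem of
    Bender and Canfield on exponentials of log-concave weights: the ratios
    r_n = p(n) / p(n+1) increase, so r_n^m is at most
    r_n r_(n+1) ... r_(n+m-1) = p(n) / p(n+m), and this is at most n + m by the
    recurrence. As k <= n, passing from n + m to n costs no more than a factor e
    in p(n-k) <= r_(n-1)^k p(n).

    It remains to estimate H = sum_(k >= 1) g_k x^k. For m < j a divisor d <= m
    of j is at most j/2, so w_j <= 2 q^(floor(j/2) - j), and with t = x^2 / q
    the sum S = sum_j w_j x^j / j is at most a constant times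
    t^(ceil((m+1)/2)) / m ([saddle_sum_le]). This last quantity is the error
    term of the theorem ([saddle_powE]). The lower bound on m enters twice: it
    keeps t below a constant smaller than 1 that depends on eps alone, so that
    the geometric sum is harmless, and it makes the error term at most
    n^(-eps/2). The recurrence for g gives H <= S (1 + H) ([sum_expc_le]), so
    H <= 2 S as soon as S <= 1/2. When S > 1/2, the bound n^(-eps/2) confines n
    to a range depending on eps alone, and there b <= 1 and p(n) >= 1/n! are
    enough. *)

(** * Coefficients of exponentials of power series *)

Section ExpCoef.
Variable R : realFieldType.
Implicit Types v w f : nat -> R.

(** The values e_n, e_(n-1), ..., e_0 of the recurrence
    n e_n = sum_j w_j e_(n-j). Keeping the whole list turns the course-of-values
    recursion into a structural one. *)
Fixpoint expc_hist w n : seq R :=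
  if n is n'.+1 then
    let s := expc_hist w n' in
    (\sum_(i < n'.+1) w i.+1 * s`_i) / n'.+1%:R :: s
  else [:: 1].

(** The coefficient of z^n in exp(sum_(j >= 1) w_j z^j / j). The lock keeps
    unification from unfolding the recurrence into a quotient. *)
Definition expc w n : R := locked (expc_hist w n)`_0.

Lemma nth_expc_hist w n i : (i <= n)%N -> (expc_hist w n)`_i = expc w (n - i).
Proof.
elim: n i => [|n IH] [|i] //= le_in; rewrite ?subn0 /expc; unlock => //=.
by rewrite subSS IH // /expc; unlock.
Qed.

Lemma expc0 w : expc w 0 = 1. Proof. by rewrite /expc; unlock. Qed.

Lemma expcS w n :
  n.+1%:R * expc w n.+1 = \sum_(i < n.+1) w i.+1 * expc w (n - i).
Proof.
rewrite {1}/expc; unlock; rewrite /= mulrC divfK ?pnatr_eq0 //.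
by apply: eq_bigr => i _; rewrite nth_expc_hist // -ltnS.
Qed.

Lemma expc_uniq w f M : f 0%N = 1 ->
  (forall n, (n < M)%N ->
     n.+1%:R * f n.+1 = \sum_(i < n.+1) w i.+1 * f (n - i)%N) ->
  forall n, (n <= M)%N -> f n = expc w n.
Proof.
move=> f0 fS; elim/ltn_ind => -[|n] IH le_nM; first by rewrite f0 expc0.
have nz : n.+1%:R != 0 :> R by rewrite pnatr_eq0.
apply: (mulfI nz); rewrite fS // expcS; apply: eq_bigr => i _.
by rewrite IH // ?ltnS ?leq_subr // (leq_trans (leq_subr _ _)) // ltnW.
Qed.

Lemma eq_expc w w' n : (forall j, (0 < j <= n)%N -> w j = w' j) ->
  expc w n = expc w' n.
Proof.
move=> ww'; apply: (@expc_uniq _ _ n); rewrite ?expc0 // => k lt_kn.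
by rewrite expcS; apply: eq_bigr => i _; rewrite ww' //= (leq_trans _ lt_kn).
Qed.

Lemma expc_ge0 w n : (forall j, 0 <= w j) -> 0 <= expc w n.
Proof.
move=> w0; elim/ltn_ind: n => -[|n] IH; first by rewrite expc0 ler01.
rewrite -(@pmulr_rge0 _ n.+1%:R) ?ltr0n // expcS sumr_ge0 // => i _.
by rewrite mulr_ge0 // IH // ltnS leq_subr.
Qed.

(** Substitution of x z for z. *)
Lemma expcZ w x n : expc (fun j => w j * x ^+ j) n = expc w n * x ^+ n.
Proof.
apply/esym; apply: (@expc_uniq _ (fun n => expc w n * x ^+ n) n) => // [|k _].
  by rewrite expc0 mulr1.
rewrite mulrA expcS big_distrl /=; apply: eq_bigr => i _.
by rewrite mulrACA -exprD addSn subnKC // -ltnS.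
Qed.

(** The exponential of a sum is a product: the convolution satisfies the
    recurrence of v + w, by the Leibniz rule applied to the polynomials that
    truncate the two series. *)
Lemma expcD v w n :
  expc (fun j => v j + w j) n = \sum_(k < n.+1) expc v k * expc w (n - k).
Proof.
pose f n := \sum_(k < n.+1) expc v k * expc w (n - k).
apply/esym; apply: (@expc_uniq _ f n) => // [|k _].
  by rewrite /f big_ord_recl big_ord0 /= !expc0 mulr1 addr0.
(* [E u] truncates exp(sum_j u_j z^j / j), and [D u] the derivative of the
   exponent; they satisfy E' = D E up to degree k. *)
pose E (u : nat -> R) : {poly R} := \poly_(i < k.+2) expc u i.
pose D (u : nat -> R) : {poly R} := \poly_(i < k.+1) u i.+1.
have fE i : (i <= k.+1)%N -> (E v * E w)`_i = f i.
  move=> le_ik; rewrite coefM; apply: eq_bigr => j _.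
  have le_ji : (j <= i)%N by rewrite -ltnS.
  by rewrite !coef_poly !ltnS (leq_trans le_ji) // (leq_trans (leq_subr _ _)).
have dE u i : (i <= k)%N -> (E u)^`()`_i = (D u * E u)`_i.
  move=> le_ik; rewrite coef_deriv coef_poly !ltnS le_ik -mulr_natl expcS coefM.
  apply: eq_bigr => j _; have le_ji : (j <= i)%N by rewrite -ltnS.
  rewrite !coef_poly !ltnS (leq_trans le_ji) // (leq_trans (leq_subr _ _)) //.
  exact: leqW.
have -> : k.+1%:R * f k.+1 = ((D v + D w) * (E v * E w))`_k.
  rewrite -fE // mulr_natl -coef_deriv derivM mulrDl !coefD; congr (_ + _).
    rewrite mulrA [LHS]coefM [RHS]coefM; apply: eq_bigr => i _; congr (_ * _).
    by rewrite dE // -ltnS.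
  rewrite mulrCA [LHS]coefM [RHS]coefM; apply: eq_bigr => i _; congr (_ * _).
  by rewrite dE // leq_subr.
rewrite coefM; apply: eq_bigr => i _.
by rewrite coefD !coef_poly ltn_ord fE // (leq_trans (leq_subr _ _)).
Qed.

(** In k e_k = sum_j w_j e_(k-j) only j <= k occur, so 1/k may be replaced by
    1/j; summing over k then bounds H by S times the sum of all e_k. *)
Lemma sum_expc_le w n : (forall j, 0 <= w j) ->
  let S := \sum_(i < n) w i.+1 / i.+1%:R in
  let H := \sum_(k < n) expc w k.+1 in
  H <= S * (1 + H).
Proof.
move=> w0 /=; set H := \sum_(k < n) _; set S := \sum_(i < n) _.
have e0 k := expc_ge0 k w0.
have step k : (k < n)%N ->
    expc w k.+1 <= \sum_(i < n | (i <= k)%N) w i.+1 / i.+1%:R * expc w (k - i).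
  move=> lt_kn; rewrite -(@ler_pM2l _ k.+1%:R) ?ltr0n // expcS mulr_sumr.
  rewrite (big_ord_widen n (fun i => w i.+1 * expc w (k - i))) //.
  apply: ler_sum => i le_ik; rewrite mulrA; apply: ler_wpM2r => //.
  rewrite mulrA ler_pdivlMr ?ltr0n // mulrC ler_wpM2r ?ler_nat //.
apply: le_trans (ler_sum _ (fun (k : 'I_n) _ => step k (ltn_ord k))) _.
rewrite (exchange_big_dep predT) //= mulr_suml; apply: ler_sum => i _.
rewrite -mulr_sumr ler_wpM2l ?divr_ge0 ?ler0n //.
have -> : 1 + H = \sum_(k < n.+1) expc w k by rewrite big_ord_recl expc0.
rewrite -(big_mkord (fun k => (i <= k)%N) (fun k => expc w (k - i))).
rewrite -(big_mkord predT (fun k => expc w k)).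
have le_in := ltnW (ltn_ord i).
rewrite big_mkcond (big_cat_nat (n := i)) //=.
rewrite big_nat big1 ?add0r; last first.
  by move=> k /=; rewrite ltnNge; case: (i <= k)%N.
rewrite -{1}[nat_of_ord i]add0n big_addn.
rewrite (@big_cat_nat _ _ _ (n - i)%N 0%N n.+1) //=; last first.
  by rewrite (leq_trans (leq_subr _ _)).
rewrite ler_wpDr ?sumr_ge0 // big_nat [leRHS]big_nat; apply: ler_sum => k _.
by rewrite leq_addl addnK.
Qed.

End ExpCoef.

(** * The density of smooth permutations and its log-concavity *)

Section SmoothDensity.
Variable R : realType.
Variable m : nat.
Hypothesis m_gt0 : (0 < m)%N.

(** The recurrence n p(n) = p(n-1) + ... + p(n-m); that p(n) is the proportion
    of m-smooth permutations is [prob_perm_smoothE]. *)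
Definition perm_density : nat -> R := expc (fun j => (j <= m)%:R).
Local Notation p := perm_density.

Lemma perm_densityS n :
  n.+1%:R * p n.+1 = \sum_(i < n.+1 | (i < m)%N) p (n - i).
Proof.
rewrite expcS [RHS]big_mkcond /=; apply: eq_bigr => i _.
by case: (i < m)%N; rewrite ?mul1r ?mul0r.
Qed.

Lemma perm_density_gt0 n : 0 < p n.
Proof.
elim/ltn_ind: n => -[|n] IH; first by rewrite /p expc0 ltr01.
rewrite -(@pmulr_rgt0 _ n.+1%:R) ?ltr0n // perm_densityS.
rewrite (bigD1 ord0) //= subn0 ltr_wpDr ?IH // sumr_ge0 // => i _.
by rewrite ltW // IH // ltnS leq_subr.
Qed.

Lemma perm_density_ge0 n : 0 <= p n. Proof. exact: ltW (perm_density_gt0 n). Qed.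

Lemma perm_densityS_full n : (m <= n)%N ->
  n%:R * p n = \sum_(i < m) p (n - i.+1).
Proof.
case: n => [|n] le_mn; first by move: m_gt0; rewrite ltnNge le_mn.
by rewrite perm_densityS -(big_ord_widen n.+1 (fun i => p (n - i))).
Qed.

Lemma perm_density1 n : (n <= m)%N -> p n = 1.
Proof.
move=> le_nm; apply/esym; apply: (@expc_uniq _ _ (fun=> 1) n) => // k lt_kn.
rewrite (eq_bigr (fun=> 1)); first by rewrite sumr_const card_ord mulr1.
by move=> i _; rewrite (leq_trans (ltn_ord i)) ?mulr1 // (leq_trans lt_kn).
Qed.

(** The difference of two consecutive instances of the recurrence: a discrete
    form of the delay equation u rho'(u) = - rho(u - 1) of the Dickman
    function. *)
Lemma perm_density_delay n : (m <= n)%N ->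
  n.+1%:R * (p n - p n.+1) = p (n - m).
Proof.
move=> le_mn; rewrite mulrBr perm_densityS_full ?(leqW le_mn) //.
rewrite -[in n.+1%:R * p n]addn1 natrD mulrDl mul1r perm_densityS_full //.
case: m m_gt0 le_mn => // k _ lt_kn.
rewrite [X in X + _ - _]big_ord_recr [X in _ - X]big_ord_recl /= subSS subn0.
rewrite [X in _ - (_ + X)](eq_bigr (fun i : 'I_k => p (n - i.+1))); last by [].
by rewrite addrAC -addrA addrC; ring.
Qed.

Definition perm_ratio n : R := p n / p n.+1.
Local Notation r := perm_ratio.

Lemma perm_ratioE n : p n = r n * p n.+1.
Proof. by rewrite /r divfK // gt_eqF ?perm_density_gt0. Qed.

Lemma perm_ratio_gt0 n : 0 < r n.
Proof. by rewrite divr_gt0 ?perm_density_gt0. Qed.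

Lemma perm_ratio_le i j : (r i <= r j) = (p i * p j.+1 <= p j * p i.+1).
Proof.
by rewrite /r ler_pdivrMr ?perm_density_gt0 // mulrAC ler_pdivlMr ?perm_density_gt0.
Qed.

(** The density is 1 up to m. Beyond that, by the delay equation, log-concavity
    at n + 1 amounts to (n+2) p(n+2) p(n-m) <= (n+1) p(n+1) p(n+1-m).
    Expanding (n+2) p(n+2) and (n+1) p(n+1) by the recurrence, this holds term
    by term, because it compares ratios of smaller index only. *)
Lemma perm_density_log_concave n : r n <= r n.+1.
Proof.
elim/ltn_ind: n => n IH; rewrite perm_ratio_le.
have mono i j : (i <= j <= n)%N -> r i <= r j.
  case/andP => + le_jn; elim: j le_jn => [|j IHj] le_jn.
    by rewrite leqn0 => /eqP ->.
  rewrite leq_eqVlt => /predU1P[->//|]; rewrite ltnS => le_ij.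
  by apply: le_trans (IHj (ltnW le_jn) le_ij) (IH _ le_jn).
have [lt_nm|le_mn] := ltnP n.+1 m.
  by rewrite !perm_density1 // ?(ltnW lt_nm) // ltnW // ltnW.
move: le_mn; rewrite leq_eqVlt => /predU1P[mn|]; [|rewrite ltnS => le_mn].
  have d := perm_density_delay (eq_leq mn).
  have e1 : p n.+1 = 1 by rewrite perm_density1 // mn.
  have e0 : p n = 1 by rewrite perm_density1 // mn.
  rewrite e0 !e1 !mul1r -subr_ge0 -e1 -(@pmulr_rge0 _ n.+2%:R) ?ltr0n // d.
  exact: perm_density_ge0.
have d1 := perm_density_delay le_mn.
have d2 := perm_density_delay (leqW le_mn).
(* The j-th terms compare the ratios at n - m and at n - j, and j < m. *)
have key : n.+2%:R * p n.+2 * p (n - m) <= n.+1%:R * p n.+1 * p (n.+1 - m).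
  rewrite !perm_densityS_full ?(leqW le_mn) ?(leqW (leqW le_mn)) //.
  rewrite !mulr_suml; apply: ler_sum => i _; rewrite subSS.
  have -> : (n.+1 - i = (n - i).+1)%N.
    by rewrite subSn // (leq_trans _ le_mn) // ltnW.
  have -> : (n.+1 - m = (n - m).+1)%N by rewrite subSn.
  rewrite mulrC -perm_ratio_le mono // leq_subr andbT leq_sub2l // ltnW //.
have q1 : p n = p n.+1 + p (n - m) / n.+1%:R.
  by rewrite -d1 mulrC mulKf ?pnatr_eq0 // addrC subrK.
have q2 : p n.+1 = p n.+2 + p (n.+1 - m) / n.+2%:R.
  by rewrite -d2 mulrC mulKf ?pnatr_eq0 // addrC subrK.
rewrite q1 [X in _ <= _ * X]q2 mulrDl mulrDr lerD2l.
rewrite mulrA [leLHS]mulrAC ler_pdivrMr ?ltr0n // [leRHS]mulrAC.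
by rewrite ler_pdivlMr ?ltr0n //; move: key; lra.
Qed.

Lemma perm_ratio_mono i j : (i <= j)%N -> r i <= r j.
Proof.
move=> /subnK <-; elim: (j - i)%N => // k IH.
exact: le_trans IH (perm_density_log_concave _).
Qed.

Lemma perm_density_prod_ratio n k :
  p n = (\prod_(i < k) r (n + i)) * p (n + k).
Proof.
elim: k => [|k IH]; first by rewrite big_ord0 mul1r addn0.
by rewrite big_ord_recr /= -mulrA addnS -perm_ratioE.
Qed.

Lemma perm_density_le_ratio n k : (k <= n.+1)%N ->
  p (n.+1 - k) <= r n ^+ k * p n.+1.
Proof.
move=> le_kn; rewrite (perm_density_prod_ratio _ k) subnK //.
rewrite ler_wpM2r ?perm_density_ge0 //.
rewrite -[k in _ ^+ k]card_ord -prodr_const; apply: ler_prod => i _.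
rewrite ltW ?perm_ratio_gt0 //= perm_ratio_mono // -ltnS.
by rewrite -[X in (_ < X)%N](subnK le_kn) ltn_add2l.
Qed.

(** The product of the m ratios from n on is p(n) / p(n + m), and p(n) is one of
    the m terms of (n + m) p(n + m). *)
Lemma perm_ratio_exp_le n : r n ^+ m <= (n + m)%:R.
Proof.
have le : r n ^+ m * p (n + m) <= p n.
  rewrite [leRHS](perm_density_prod_ratio n m) ler_wpM2r ?perm_density_ge0 //.
  rewrite -[m in _ ^+ m]card_ord -prodr_const; apply: ler_prod => i _.
  by rewrite ltW ?perm_ratio_gt0 //= perm_ratio_mono // leq_addr.
rewrite -(@ler_pM2r _ (p (n + m))) ?perm_density_gt0 //.
apply: le_trans le _; rewrite perm_densityS_full ?leq_addl //.
case: m m_gt0 => // k _; rewrite big_ord_recr /= addnK.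
by rewrite ler_wpDl ?sumr_ge0 // => i _; exact: perm_density_ge0.
Qed.

(** (n + m)^(k/m) = n^(k/m) (1 + m/n)^(k/m), and the last factor is at most
    exp(k/n) <= e. *)
Lemma perm_density_shift n k : (0 < n)%N -> (k <= n)%N ->
  p (n - k) <= expR 1 * (n%:R `^ (m%:R^-1)) ^+ k * p n.
Proof.
case: n => // n _ le_kn; apply: le_trans (perm_density_le_ratio le_kn) _.
rewrite ler_wpM2r ?perm_density_ge0 //.
have m0 : (0 : R) < m%:R by rewrite ltr0n.
have n0 : (0 : R) < n.+1%:R by rewrite ltr0n.
have r_le : r n <= expR (n.+1%:R^-1) * n.+1%:R `^ (m%:R^-1).
  rewrite -(@ler_pXn2r _ m) // ?nnegrE ?(ltW (perm_ratio_gt0 _)) //; last first.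
    by rewrite mulr_ge0 ?expR_ge0 ?powR_ge0.
  apply: le_trans (perm_ratio_exp_le n) _.
  rewrite exprMn -[X in _ * X]powR_mulrn ?powR_ge0 // -powRrM mulVf ?gt_eqF //.
  rewrite (powRr1 (ltW n0)) -expRM_natl mulrC.
  have := expR_ge1Dx (m%:R * n.+1%:R^-1 : R).
  rewrite -(ler_pM2l n0) mulrDr mulr1 mulrCA mulfV ?gt_eqF // mulr1.
  by rewrite -natrD; apply: le_trans; rewrite ler_nat leq_add2r.
apply: (@le_trans _ _ ((expR n.+1%:R^-1 * n.+1%:R `^ m%:R^-1) ^+ k)).
  by apply: lerXn2r; rewrite ?nnegrE ?(ltW (perm_ratio_gt0 _)) ?mulr_ge0 ?expR_ge0 ?powR_ge0.
rewrite exprMn ler_wpM2r ?exprn_ge0 ?powR_ge0 // -expRM_natl ler_expR.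
by rewrite ler_pdivrMr // mul1r ler_nat.
Qed.

Lemma perm_density_ge_fact n : n`!%:R^-1 <= p n.
Proof.
elim: n => [|n IH]; first by rewrite invr1 /p expc0.
rewrite factS natrM invfM ler_pdivrMl ?ltr0n // perm_densityS.
rewrite (bigD1 ord0) //= subn0 ler_wpDr // sumr_ge0 // => i _.
exact: perm_density_ge0.
Qed.

End SmoothDensity.

(** * Counting smooth permutations *)

Section PermCycles.
Variable T : finType.
Implicit Types (x y z : T) (A : {set T}) (s : {perm T}).

Lemma porbit_step s x y : y \in porbit s x -> s y \in porbit s x.
Proof. by case/porbitP=> i ->; rewrite -permM -expgSr mem_porbit. Qed.

(** Multiplying by the transposition of x and a fixed point y inserts y into the
    cycle of x, right after x. *)
Lemma porbit_tperm_mul s x y : x != y -> s y = y ->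
  porbit (tperm x y * s)%g x = y |: porbit s x.
Proof.
move=> nxy sy; set t := (tperm x y * s)%g.
have tx : t x = y by rewrite permM tpermL.
have ty : t y = s x by rewrite permM tpermR.
have tz z : z != x -> z != y -> t z = s z.
  by move=> zx zy; rewrite permM tpermD // eq_sym.
apply/setP => z; apply/idP/idP.
  case/porbitP => i ->; elim: i => [|i].
    by rewrite expg0 perm1 !inE porbit_id orbT.
  rewrite expgSr permM; move: ((t ^+ i)%g x) => w.
  have [-> _|wx] := eqVneq w x; first by rewrite tx setU11.
  have [-> _|wy] := eqVneq w y; first by rewrite ty setU1r // (mem_porbit s 1).
  by rewrite tz // !inE (negPf wy) /= => /porbit_step ->; rewrite orbT.
case/setU1P => [->|/porbitP [i ->]]; first by rewrite -tx (mem_porbit t 1).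
elim: i => [|i]; first by rewrite expg0 perm1 porbit_id.
rewrite expgSr permM; move: ((s ^+ i)%g x) => w.
have [-> _|wx] := eqVneq w x.
  by rewrite -ty -tx -!permM; exact: (mem_porbit t 2).
have [->|wy wt] := eqVneq w y; first by rewrite sy.
by rewrite -tz // porbit_step.
Qed.

Lemma porbit_tperm_mulD s x y z : x != y -> s y = y ->
  z \notin y |: porbit s x -> porbit (tperm x y * s)%g z = porbit s z.
Proof.
move=> nxy sy zNx; set t := (tperm x y * s)%g.
have it i : (t ^+ i)%g z = (s ^+ i)%g z.
  elim: i => [|i IH]; first by rewrite !expg0.
  rewrite !expgSr !permM IH; set w := (s ^+ i)%g z.
  have : w \notin y |: porbit s x.
    apply: contra zNx; rewrite !inE => /orP [/eqP wy|].
      have : z \in porbit s w by rewrite porbit_sym mem_porbit.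
      rewrite wy => /porbitP [j ->]; rewrite permX.
      elim: j => [|j /= /orP [/eqP ->|]]; rewrite ?eqxx //= ?sy ?eqxx //.
      by move=> /porbit_step ->; rewrite orbT.
    by rewrite -!eq_porbit_mem porbit_perm => ->; rewrite orbT.
  rewrite !inE negb_or => /andP [wy wx]; rewrite tpermD // eq_sym //.
  by apply: contraNneq wx => ->; rewrite porbit_id.
by apply/setP => w; apply/porbitP/porbitP => -[i ->]; exists i.
Qed.

Lemma porbit_fix s x : s x = x -> porbit s x = [set x].
Proof.
move=> sx; apply/setP => z; rewrite inE; apply/porbitP/eqP => [[i ->]|->].
  by rewrite permX; elim: i => //= i ->.
by exists 0%N; rewrite expg0 perm1.
Qed.

Lemma perm_on_tperm_mul s x y A : x \in A -> y \in A -> x != y -> s y = y ->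
  perm_on A (tperm x y * s)%g = perm_on (A :\ y) s.
Proof.
move=> xA yA nxy sy; apply/subsetP/subsetP => H z; rewrite inE => sz.
  have zy : z != y by apply: contraNneq sz => ->; rewrite sy.
  rewrite !inE zy /=; have [->//|zx] := eqVneq z x.
  by apply: H; rewrite inE permM tpermD // eq_sym.
have [->//|zx] := eqVneq z x; have [->//|zy] := eqVneq z y.
have := H z; rewrite !inE zy /=; apply.
by move: sz; rewrite permM tpermD // eq_sym.
Qed.

Variable m : nat.
Hypothesis m_gt0 : (0 < m)%N.

Definition smooth_on A : {set {perm T}} :=
  [set s | perm_on A s & [forall z, #|porbit s z| <= m]%N].

(** Leaving the length j of the cycle of x unconstrained lets its points be
    removed one at a time. *)
Definition smooth_outside A x j : {set {perm T}} :=
  [set s | [&& perm_on A s, #|porbit s x| == j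
             & [forall z, (z \notin porbit s x) ==> (#|porbit s z| <= m)%N]]].

Lemma card_smooth_outside1 A x : x \in A ->
  #|smooth_outside A x 1| = #|smooth_on (A :\ x)|.
Proof.
move=> xA; apply: eq_card => s; rewrite !inE.
apply/and3P/andP => [[sA /cards1P[x0 sx] /forallP sm]|[sA sm]].
  have x0E : x = x0 by apply/set1P; rewrite -sx porbit_id.
  rewrite -{}x0E in sx.
  have sx1 : s x = x by apply/set1P; rewrite -sx (mem_porbit s 1).
  split.
    apply/subsetP => z sz; rewrite !inE (subsetP sA) // andbT.
    by apply: contraNneq sz => ->; rewrite sx1.
  apply/forallP => z; have := sm z; rewrite sx inE.
  by case: eqP => //= ->; rewrite sx cards1.
have sx : s x = x by apply: (out_perm sA); rewrite !inE eqxx.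
rewrite (porbit_fix sx) cards1; split => //.
  by apply: subset_trans sA _; rewrite subsetDl.
by apply/forallP => z; rewrite (forallP sm) implybT.
Qed.

(** Removing from the cycle of x the point y that follows x. *)
Lemma card_smooth_outsideS A x j : x \in A ->
  #|smooth_outside A x j.+2| =
    (\sum_(y in A :\ x) #|smooth_outside (A :\ y) x j.+1|)%N.
Proof.
move=> xA.
rewrite -sum1_card (partition_big (fun s : {perm T} => s x) (mem (A :\ x))) /=.
  apply: eq_bigr => y; rewrite !inE => /andP [yx yA]; rewrite sum1_card.
  have tI : injective (mulg (tperm x y)) by apply: mulgI.
  rewrite -(card_imset _ tI) /=; apply: eq_card => s.
  have nxy : x != y by rewrite eq_sym.
  have eqs (u : {perm T}) : u y = y ->
     ((tperm x y * u)%g \in smooth_outside A x j.+2) =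
       (u \in smooth_outside (A :\ y) x j.+1).
    move=> uy; rewrite !inE perm_on_tperm_mul // porbit_tperm_mul // cardsU1.
    have -> : y \notin porbit u x.
      by rewrite porbit_sym porbit_fix // inE.
    rewrite add1n eqSS; congr [&& _, _ & _].
    apply/forallP/forallP => sm z; apply/implyP => zx; have /implyP := sm z.
      have [->|zy] := eqVneq z y; first by rewrite (porbit_fix uy) cards1.
      by rewrite porbit_tperm_mulD ?inE ?(negPf zy) //; apply.
    rewrite porbit_tperm_mulD //; apply.
    by move: zx; rewrite !inE negb_or => /andP[].
  apply/imsetP/idP => [[u] |su].
    rewrite [u \in _]unfold_in => /andP [uA /eqP uxy] ->.
    by rewrite -eqs ?permM ?tpermR // mulgA tperm2 mul1g.
  exists (tperm x y * s)%g; last by rewrite mulgA tperm2 mul1g.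
  have sy : s y = y.
    move: su; rewrite inE => /and3P [sA _ _].
    by apply: (out_perm sA); rewrite !inE eqxx.
  by rewrite unfold_in /= permM tpermL sy eqxx andbT eqs.
move=> s; rewrite !inE => /and3P [sA sx _].
have sxx : s x != x.
  by apply: contraTneq sx => /porbit_fix ->; rewrite cards1.
by rewrite sxx perm_closed.
Qed.

Lemma card_smooth_on A x : x \in A ->
  #|smooth_on A| = (\sum_(j < m) #|smooth_outside A x j.+1|)%N.
Proof.
move=> xA; rewrite -sum1_card.
have mE : m = m.-1.+1 by rewrite prednK.
rewrite mE.
pose len (s : {perm T}) : 'I_m.-1.+1 := inord (#|porbit s x|.-1).
rewrite (partition_big len predT) //=.
apply: eq_bigr => j _; rewrite sum1_card; apply: eq_card => s.
rewrite unfold_in /= !inE -!andbA; case: (perm_on A s) => //=.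
have xgt0 : (0 < #|porbit s x|)%N by rewrite lt0n card_porbit_neq0.
apply/andP/andP => [[/forallP sm /eqP sj]|[/eqP sj /forallP sm]].
  split; last by apply/forallP => z; rewrite sm implybT.
  by rewrite -sj inordK ?prednK // -mE.
split; last by rewrite /len sj /= inord_val.
apply/forallP => z; have [|/(implyP (sm z)) //] := boolP (z \in porbit s x).
rewrite -eq_porbit_mem => /eqP ->; rewrite sj.
by apply: leq_trans (ltn_ord j) _; rewrite prednK.
Qed.

End PermCycles.

Section SmoothPermDensity.
Variable R : realType.
Variables (T : finType) (m : nat).
Hypothesis m_gt0 : (0 < m)%N.
Local Notation p := (perm_density R m).

(** The product of the numbers of choices for the successors of x is a falling
    factorial, which complements (#|A| - j - 1)! to (#|A| - 1)!: the count
    depends on j only through the density of what remains. *)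
Lemma card_smooth_outside_density a :
  (forall A : {set T}, (#|A| < a)%N -> #|smooth_on m A|%:R = #|A|`!%:R * p #|A|) ->
  forall j (A : {set T}) x, x \in A -> (#|A| <= a)%N ->
  #|smooth_outside m A x j.+1|%:R =
    if (j < #|A|)%N then (#|A|.-1)`!%:R * p (#|A| - j.+1) else 0.
Proof.
move=> IH; elim=> [|j IHj] A x xA leAa.
  have cA : #|A| = #|A :\ x|.+1 by rewrite (cardsD1 x) xA.
  by rewrite card_smooth_outside1 // IH -?cA // cA subn1.
rewrite card_smooth_outsideS // natr_sum.
have cA y : y \in A -> #|A| = #|A :\ y|.+1 by move=> yA; rewrite (cardsD1 y) yA.
rewrite (eq_bigr (fun=>
  if (j.+1 < #|A|)%N then (#|A|.-2)`!%:R * p (#|A| - j.+2) else 0)).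
  rewrite sumr_const; have := cA x xA; case: #|A| => // c [<-].
  case: c => [|c] //=; rewrite !ltnS subSS; case: leqP => _; last by rewrite mul0rn.
  by rewrite -mulrnAl -mulrnA mulnC.
move=> y; rewrite !inE => /andP [yx yA].
rewrite IHj ?inE 1?eq_sym ?yx ?xA //; last by rewrite -ltnS -cA // ltnW.
by rewrite (cA y yA) subSS ltnS.
Qed.

(** The sum over the length of the cycle of a point of A is the recurrence
    defining [perm_density]. *)
Lemma card_smooth_on_density (A : {set T}) :
  #|smooth_on m A|%:R = #|A|`!%:R * p #|A|.
Proof.
have [a leAa] := ubnP #|A|; elim: a A leAa => // a IH A; rewrite ltnS => leAa.
have [->|[x xA]] := set_0Vmem A.
  rewrite cards0 mul1r /perm_density expc0 (_ : smooth_on m set0 = [set 1%g]) ?cards1 //.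
  apply/setP => s; rewrite !inE; apply/andP/eqP => [[s1 _]|->].
    by apply/permP => z; rewrite perm1 (out_perm s1) ?inE.
  split; first exact: perm_on1.
  by apply/forallP => z; rewrite porbit_fix ?perm1 // cards1.
rewrite (card_smooth_on m_gt0 xA) natr_sum.
under eq_bigr do rewrite (card_smooth_outside_density IH) //.
have [c cA] : exists c, #|A| = c.+1 by exists #|A :\ x|; rewrite (cardsD1 x) xA.
rewrite cA /= factS natrM -mulrA [RHS]mulrCA perm_densityS // mulr_sumr.
under eq_bigr do rewrite ltnS subSS.
rewrite -big_mkcond /=.
rewrite -(big_mkord (fun j => (j <= c)%N) (fun j => c`!%:R * p (c - j))).
rewrite -(big_mkord (fun j => (j < m)%N) (fun j => c`!%:R * p (c - j))).
rewrite (big_nat_widen _ _ (maxn m c.+1)) ?leq_maxl //.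
rewrite [RHS](big_nat_widen _ _ (maxn m c.+1)) ?leq_maxr //.
by apply: eq_bigl => j; rewrite ltnS andbC.
Qed.

End SmoothPermDensity.

Lemma prob_perm_smoothE (R : realType) n m : (0 < m)%N ->
  prob_perm_smooth R n m = perm_density R m n.
Proof.
move=> m_gt0; rewrite /prob_perm_smooth /unif_prob cardsT card_Sn.
rewrite (_ : [set x in _ | _] = smooth_on m [set: 'I_n]).
  rewrite card_smooth_on_density // cardsT card_ord mulrC mulKf //.
  by rewrite pnatr_eq0 -lt0n fact_gt0.
apply/setP => s; rewrite !inE /=; apply/asboolP/andP => [sm|[_ /forallP sm] C].
  split; first by apply/subsetP => z; rewrite inE.
  by apply/forallP => z; apply: sm; apply: imset_f.
by case/imsetP => z _ ->.
Qed.

(** * Counting smooth polynomials over a finite field *)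

Section PolyFactors.
Variable F : finFieldType.
Implicit Types (f g P Q : {poly F}).

Definition prime_poly P := (P \is monic) && irreducibleb P.

Lemma prime_polyP P : reflect (P \is monic /\ irreducible_poly P) (prime_poly P).
Proof. by apply: (iffP andP) => -[? /irreducibleP]. Qed.

Lemma prime_poly_monic P : prime_poly P -> P \is monic.
Proof. by case/andP. Qed.

Lemma prime_poly_size P : prime_poly P -> (1 < size P)%N.
Proof. by case/prime_polyP => _ []. Qed.

Lemma prime_poly_neq0 P : prime_poly P -> P != 0.
Proof. by move/prime_poly_monic/monic_neq0. Qed.

Lemma monic_sizeS f : f \is monic -> size f = (size f).-1.+1.
Proof. by move=> mf; rewrite prednK // size_poly_gt0 monic_neq0. Qed.

Lemma deg_monicM f g : f \is monic -> g \is monic ->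
  (size (f * g)).-1 = ((size f).-1 + (size g).-1)%N.
Proof.
move=> mf mg; rewrite size_monicM ?monic_neq0 //.
by rewrite (monic_sizeS mf) (monic_sizeS mg) addSn addnS.
Qed.

Lemma deg_monicX f k : f \is monic -> (size (f ^+ k)).-1 = (k * (size f).-1)%N.
Proof.
move=> mf; elim: k => [|k IH]; first by rewrite expr0 size_poly1.
by rewrite exprS deg_monicM ?monic_exp // IH mulSn.
Qed.

Lemma prime_poly_dvd_prime P Q : prime_poly P -> prime_poly Q ->
  (P %| Q) = (P == Q).
Proof.
move=> pP pQ; apply/idP/eqP => [PQ|->]; last exact: dvdpp.
have [_ [_ irrQ]] := prime_polyP _ pQ.
apply/eqP; rewrite -eqp_monic ?prime_poly_monic // irrQ //.
by rewrite gtn_eqF // prime_poly_size.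
Qed.

Lemma prime_poly_dvdX P Q k g : prime_poly P -> prime_poly Q -> P != Q ->
  (P ^+ k %| Q * g) = (P ^+ k %| g).
Proof.
move=> pP pQ nPQ; apply: Gauss_dvdpr; apply: coprimep_expl.
rewrite irreducible_poly_coprime ?prime_poly_dvd_prime //.
by case/prime_polyP: pP.
Qed.

Lemma prime_factor f : f \is monic -> (1 < size f)%N ->
  exists2 P, prime_poly P & P %| f.
Proof.
have [s] := ubnP (size f); elim: s f => // s IH f; rewrite ltnS => les mf f1.
have [irr|] := boolP (irreducibleb f); first by exists f; rewrite ?dvdpp // /prime_poly mf.
rewrite /irreducibleb f1 negb_forall => /existsP [g].
rewrite negb_imply -ltnNge -Pdiv.Idomain.dvdpE => /andP [gf g1].
have g0 : lead_coef g != 0.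
  by rewrite lead_coef_eq0; apply: contraTneq g1 => ->; rewrite size_poly0.
have szg : size ((lead_coef g)^-1 *: (g : {poly F})) = size g.
  by rewrite size_scale // invr_eq0.
have [|||P pP Pg] := IH ((lead_coef g)^-1 *: (g : {poly F})).
- rewrite szg; apply: leq_trans les; apply: leq_ltn_trans (size_npoly g) _.
  by rewrite prednK // (ltn_trans _ f1).
- by rewrite monicE lead_coefZ mulVf.
- by rewrite szg.
exists P => //; apply: dvdp_trans Pg _; apply: dvdp_trans gf.
by rewrite dvdpZl ?invr_eq0.
Qed.

Variable M : nat.
Local Notation T := {poly_M F}.

(** The degree of a monic polynomial is the sum of deg P over the prime powers
    P^k, k >= 1, that divide it. Passing from g to Q g with Q prime adds one
    power of Q and none of the other primes. *)
Lemma sum_prime_powers f : f \is monic -> (size f <= M)%N ->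
  (\sum_(P : T | prime_poly P) \sum_(k < M) (polyn P ^+ k.+1 %| f)%R * (size P).-1
   = (size f).-1)%N.
Proof.
have [s] := ubnP (size f); elim: s f => // s IH f; rewrite ltnS => les mf fM.
have [f1|f1] := leqP (size f) 1.
  have -> : f = 1.
    apply/eqP; rewrite -eqp_monic ?monic1 // -size_poly_eq1 eqn_leq f1.
    by rewrite (monic_sizeS mf).
  rewrite size_poly1 big1 // => P pP; rewrite big1 // => k _.
  rewrite dvdp1 -[size _]prednK ?size_poly_gt0 ?expf_neq0 ?prime_poly_neq0 //.
  rewrite deg_monicX ?prime_poly_monic //.
  by case: (size P) (prime_poly_size pP) => [|[]].
have [Q pQ /dvdpP [g fE]] := prime_factor mf f1; rewrite mulrC in fE.
have mQ := prime_poly_monic pQ; have Q1 := prime_poly_size pQ.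
have mg : g \is monic by rewrite -(monicMl g mQ) -fE.
have szf : (size f).-1 = ((size Q).-1 + (size g).-1)%N by rewrite fE deg_monicM.
have szg : (size g < size f)%N.
  by move: szf (monic_sizeS mf) (monic_sizeS mg) Q1; lia.
have QM : (size Q <= M)%N.
  by rewrite (leq_trans _ fM) //; move: szf (monic_sizeS mf) (monic_sizeS mQ); lia.
have gM : (size g <= M)%N by rewrite (leq_trans (ltnW szg)).
rewrite szf -(IH g) ?(leq_trans szg) //.
pose Q' : T := NPoly (QM : Q \is a poly_of_size M).
rewrite (bigD1 Q') //= [in RHS](bigD1 Q') //= addnA; congr (_ + _)%N; last first.
  apply: eq_bigr => P /andP [pP nPQ]; apply: eq_bigr => k _.
  by rewrite fE prime_poly_dvdX.
have E k : (Q ^+ k.+1 %| f) = (Q ^+ k %| g).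
  by rewrite fE exprS dvdp_mul2l ?prime_poly_neq0.
case: M fM => [|M'] fM; first by rewrite (monic_sizeS mf) in fM.
under eq_bigr do rewrite E.
(* The exponents range over 1..M on both sides; the shift by one brings in
   Q^0 and drops Q^M, whose degree is too large for it to divide g. *)
rewrite big_ord_recl [in RHS]big_ord_recr /= expr0 dvd1p mul1n.
congr (_ + _)%N; rewrite (_ : (Q ^+ M'.+1 %| g) = false) ?addn0 //.
apply/negP => /(dvdp_leq (monic_neq0 mg)); apply/negP; rewrite -ltnNge.
rewrite (leq_trans szg) // (leq_trans fM) //.
rewrite (monic_sizeS (monic_exp _ mQ)) deg_monicX // ltnW // ltnS leq_pmulr //.
by case: (size Q) Q1 => [|[]].
Qed.

Lemma poly_smoothM m P g : prime_poly P -> ((size P).-1 <= m)%N ->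
  poly_smooth m (P * g) <-> poly_smooth m g.
Proof.
move=> pP Pm; split => [sm Q iQ Qg|sm Q iQ].
  by apply: sm => //; apply: dvdp_mull.
have [QP _|nQP] := boolP (Q %| P).
  have [_ [_ irrP]] := prime_polyP _ pP.
  rewrite (eqp_size (irrP Q _ QP)) //.
  by rewrite gtn_eqF //; case: iQ.
by rewrite Gauss_dvdpr ?irreducible_poly_coprime //; apply: sm.
Qed.

Lemma poly_smoothXM m P g k : prime_poly P -> ((size P).-1 <= m)%N ->
  poly_smooth m (P ^+ k * g) <-> poly_smooth m g.
Proof.
move=> pP Pm; elim: k => [|k IH]; first by rewrite expr0 mul1r.
by rewrite exprS -mulrA poly_smoothM.
Qed.

(** All degrees are counted inside one finite type of polynomials of size at
    most M, so that the recurrence relates subsets of the same type. *)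
Definition smooth_polys m i : {set T} :=
  [set f : T | [&& polyn f \is monic, size (polyn f) == i.+1
                & `[< poly_smooth m (polyn f) >]]].

(** A smooth multiple of P forces deg P <= m, and then division by P^(k+1) is a
    bijection onto the smooth polynomials of the complementary degree. *)
Lemma card_smooth_polys_dvd m i P k : prime_poly P -> (i < M)%N ->
  #|[set f in smooth_polys m i | P ^+ k.+1 %| polyn f]| =
    if ((size P).-1 <= m)%N && (k.+1 * (size P).-1 <= i)%N then
      #|smooth_polys m (i - k.+1 * (size P).-1)| else 0%N.
Proof.
move=> pP lt_iM; have mP := prime_poly_monic pP.
have mPk := monic_exp k.+1 mP.
case: ifP => [/andP [Pm ki]|H]; last first.
  apply/eqP; rewrite cards_eq0 -subset0; apply/subsetP => f; rewrite !inE.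
  case/andP => /and3P [mf szf /asboolP sm] Pf; move: H => /negbT/negP; case.
  rewrite sm; [|by case/prime_polyP: pP|]; last first.
    by apply: dvdp_trans Pf; rewrite exprS dvdp_mulr.
  have /= := dvdp_leq (monic_neq0 mf) Pf.
  by rewrite (monic_sizeS mPk) deg_monicX // (eqP szf) ltnS.
set s := (k.+1 * _)%N in ki *.
have szPk : size (P ^+ k.+1) = s.+1 by rewrite (monic_sizeS mPk) deg_monicX.
have sizeM g : g \is monic -> size g = (i - s).+1 -> size (P ^+ k.+1 * g) = i.+1.
  move=> mg szg; rewrite monic_sizeS ?monicMl // deg_monicM // szPk szg.
  by rewrite addnC subnK.
pose mulP (g : T) : T := npolyp M (P ^+ k.+1 * g).
have mulPE (g : T) : g \in smooth_polys m (i - s) -> mulP g = P ^+ k.+1 * g :> {poly F}.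
  by rewrite inE => /and3P [mg /eqP szg _]; rewrite npolypK // sizeM.
have mulP_inj : {in smooth_polys m (i - s) &, injective mulP}.
  move=> g h Sg Sh /(congr1 (@polyn F M)); rewrite !mulPE //.
  by move/(mulfI (monic_neq0 mPk))/val_inj.
rewrite -(card_in_imset mulP_inj); apply: eq_card => f.
apply/idP/imsetP => [|[g Sg ->]]; last first.
  rewrite inE mulPE // dvdp_mulr // andbT inE mulPE //.
  move: Sg; rewrite inE => /and3P [mg /eqP szg /asboolP smg].
  by rewrite monicMl // mg sizeM // eqxx /=; apply/asboolP/poly_smoothXM.
rewrite inE => /andP [+ /dvdpP [g fE]]; rewrite mulrC in fE.
rewrite inE fE monicMl // => /and3P [mg /eqP szf /asboolP smf].
have szg : size g = (i - s).+1.
  move: szf; rewrite (monic_sizeS (_ : _ * g \is monic)) ?monicMl // deg_monicM //.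
  by rewrite szPk (monic_sizeS mg) => -[<-]; rewrite addKn.
have gM : (size g <= M)%N by rewrite szg (leq_ltn_trans (leq_subr _ _)).
have Sg : NPoly (gM : g \is a poly_of_size M) \in smooth_polys m (i - s).
  rewrite inE /= mg szg eqxx; apply/asboolP.
  by move: smf => /(poly_smoothXM g k.+1 pP Pm).
by exists (NPoly (gM : g \is a poly_of_size M)) => //; apply: val_inj; rewrite /= mulPE.
Qed.

Lemma card_monic_polys i : (i < M)%N ->
  #|[set f : T | (polyn f \is monic) && (size (polyn f) == i.+1)]| = (#|F| ^ i)%N.
Proof.
move=> iM; rewrite -card_npoly.
pose addX (g : {poly_i F}) : T := npolyp M ('X^i + polyn g).
have szX (g : {poly_i F}) : size ('X^i + polyn g) = i.+1.
  by rewrite size_polyDl size_polyXn // ltnS size_npoly.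
have addXE (g : {poly_i F}) : addX g = 'X^i + g :> {poly F} by rewrite npolypK // szX.
have addX_inj : injective addX.
  move=> g h /(congr1 (@polyn F M)); rewrite !addXE.
  by move/addrI/val_inj.
rewrite -(card_imset _ addX_inj); apply: eq_card => f.
apply/idP/imsetP => [|[g _ ->]]; last first.
  rewrite inE addXE szX eqxx andbT monicE lead_coefDl ?lead_coefXn //.
  by rewrite size_polyXn ltnS size_npoly.
rewrite inE => /andP [mf /eqP szf].
have gi : (size (polyn f - 'X^i)%R <= i)%N.
  apply/leq_sizeP => j; rewrite leq_eqVlt => /predU1P [<-|lt_ij].
    move: mf; rewrite monicE lead_coefE szf /= coefB coefXn eqxx => /eqP ->.
    by rewrite subrr.
  by rewrite coefB coefXn gtn_eqF // nth_default ?szf // subrr.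
exists (NPoly (gi : _ \is a poly_of_size i)) => //.
by apply: val_inj; rewrite /= addXE /= addrC subrK.
Qed.

(** The sum of deg P over the powers P^k of degree N of primes P of degree at
    most m, that is the sum of d pi(d) over the divisors d <= m of N. *)
Definition prime_power_weight m N : nat :=
  (\sum_(P : T | prime_poly P && ((size (polyn P)).-1 <= m))
    \sum_(k < M) (k.+1 * (size (polyn P)).-1 == N) * (size (polyn P)).-1)%N.

(** Double counting of the pairs (f, P^k) with P^k dividing f, each with weight
    deg P. *)
Lemma smooth_polys_rec m i : (i < M)%N ->
  (i * #|smooth_polys m i| =
   \sum_(j < i) prime_power_weight m j.+1 * #|smooth_polys m (i - j.+1)|)%N.
Proof.
move=> iM.
transitivity (\sum_(P : T | prime_poly P) \sum_(k < M)
   (size (polyn P)).-1 * #|[set f in smooth_polys m i | (polyn P ^+ k.+1 %| polyn f)%R]|)%N.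
  transitivity (\sum_(f in smooth_polys m i)
     \sum_(P : T | prime_poly P) \sum_(k < M)
       (polyn P ^+ k.+1 %| polyn f)%R * (size (polyn P)).-1)%N.
    rewrite mulnC -sum_nat_const; apply: eq_bigr => f; rewrite inE.
    by case/and3P => mf /eqP szf _; rewrite sum_prime_powers ?szf.
  rewrite exchange_big /=; apply: eq_bigr => P pP.
  rewrite exchange_big /=; apply: eq_bigr => k _.
  rewrite -big_distrl /= mulnC; congr (_ * _)%N.
  rewrite -sum1_card [RHS](eq_bigl (fun f : T =>
    (f \in smooth_polys m i) && (polyn P ^+ k.+1 %| polyn f))).
    by rewrite [RHS]big_mkcondr.
  by move=> f; rewrite inE.
under [RHS]eq_bigr do rewrite /prime_power_weight big_distrl /=.
rewrite [RHS]exchange_big /= [LHS](bigID (fun P : T => (size (polyn P)).-1 <= m)%N) /=.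
rewrite [X in (_ + X)%N]big1 ?addn0; last first.
  move=> P /andP [pP /negPf Pm]; rewrite big1 // => k _.
  by rewrite card_smooth_polys_dvd // Pm muln0.
apply: eq_bigr => P /andP [pP Pm].
under [RHS]eq_bigr do rewrite big_distrl /=.
rewrite [RHS]exchange_big /=; apply: eq_bigr => k _.
rewrite card_smooth_polys_dvd // Pm /=.
have : (0 < k.+1 * (size (polyn P)).-1)%N.
  by rewrite muln_gt0 /=; case: (size _) (prime_poly_size pP) => [|[]].
case: (k.+1 * (size (polyn P)).-1)%N => // s _; case: ltnP => [lt_si|le_is].
  rewrite (bigD1 (Ordinal lt_si)) //= eqxx mul1n big1 ?addn0 // => j nj.
  by rewrite eqSS eq_sym [(_ == s)](negPf nj).
rewrite muln0 big1 // => j _.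
by rewrite eqSS gtn_eqF // (leq_trans (ltn_ord j)).
Qed.

(** Gauss's formula: the sum of d pi(d) over all divisors d of N is q^N. It is
    read off the recurrence for all monic polynomials, whose numbers q^i are
    known: subtract q times the instance for N - 1 from the instance for N. *)
Lemma prime_power_weight_full N : (0 < N < M)%N ->
  prime_power_weight M N = (#|F| ^ N)%N.
Proof.
case/andP => N0 NM.
have card_all i : (i < M)%N -> #|smooth_polys M i| = (#|F| ^ i)%N.
  move=> iM; rewrite -card_monic_polys //; apply: eq_card => f; rewrite !inE.
  case mf: (polyn f \is monic) => //=; case: eqP => //= szf.
  apply/asboolP => g _ /(dvdp_leq (monic_neq0 mf)) le_gf.
  by rewrite (leq_trans (leq_pred _)) // (leq_trans le_gf) // size_npoly.
case: N N0 NM => // N _ NM.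
have := smooth_polys_rec M NM; rewrite card_all // big_ord_recr /= subnn.
rewrite card_all ?(leq_ltn_trans _ NM) // expn0 muln1.
have -> : (\sum_(j < N) prime_power_weight M j.+1 * #|smooth_polys M (N.+1 - j.+1)|
     = #|F| * \sum_(j < N) prime_power_weight M j.+1 * #|smooth_polys M (N - j.+1)|)%N.
  rewrite big_distrr /=; apply: eq_bigr => j _.
  rewrite subSS !card_all ?(leq_ltn_trans (leq_subr _ _)) ?(ltnW NM) //.
  by rewrite -subnSK // expnS mulnCA.
rewrite -smooth_polys_rec ?(ltn_trans _ NM) // card_all ?(ltn_trans _ NM) //.
by rewrite mulSn expnS mulnCA addnC => /addnI.
Qed.

Lemma prime_power_weight_le_full m N : (N <= m)%N -> (0 < N < M)%N ->
  prime_power_weight m N = (#|F| ^ N)%N.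
Proof.
move=> Nm NM; rewrite -prime_power_weight_full // /prime_power_weight.
rewrite big_mkcondr [RHS]big_mkcondr; apply: eq_bigr => P pP.
have -> : ((size (polyn P)).-1 <= M)%N by rewrite (leq_trans (leq_pred _)) // size_npoly.
case: leqP => // mP; rewrite big1 // => k _; rewrite gtn_eqF // (leq_ltn_trans Nm) //.
by rewrite (leq_trans mP) // leq_pmull.
Qed.

Lemma prime_poly_degree_sum d : (0 < d < M)%N ->
  (\sum_(P : T | prime_poly P && ((size (polyn P)).-1 == d)) (size (polyn P)).-1
     <= #|F| ^ d)%N.
Proof.
move=> dM; rewrite -prime_power_weight_full // /prime_power_weight.
rewrite [X in (X <= _)%N]big_mkcondr [X in (_ <= X)%N]big_mkcondr; apply: leq_sum => P pP.
have -> : ((size (polyn P)).-1 <= M)%N by rewrite (leq_trans (leq_pred _)) // size_npoly.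
case: eqP => // Pd; have M0 : (0 < M)%N by case/andP: dM => _; apply: leq_ltn_trans.
by rewrite (bigD1 (Ordinal M0)) //= mul1n Pd eqxx mul1n leq_addr.
Qed.

(** A divisor of N that is smaller than N is at most N/2, and each degree d
    contributes d pi(d) <= q^d. *)
Lemma prime_power_weight_le m N : (m < N < M)%N ->
  (prime_power_weight m N <= 2 * #|F| ^ N./2)%N.
Proof.
case/andP => mN NM.
have F1 : (1 < #|F|)%N by exact: card_finNzRing_gt1.
apply: (@leq_trans (\sum_(P : T | prime_poly P && ((size (polyn P)).-1 <= N./2)%N)
  (size (polyn P)).-1)).
  rewrite /prime_power_weight big_mkcondr [X in (_ <= X)%N]big_mkcondr.
  apply: leq_sum => P pP; have P1 := prime_poly_size pP.
  case: (leqP _ m) => // Pm.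
  (* At most one power of P has degree N, and as deg P <= m < N its exponent
     is at least 2. *)
  have le1 : (\sum_(k < M) (k.+1 * (size (polyn P)).-1 == N)
                <= ((size (polyn P)).-1 <= N./2))%N.
    have [/existsP [k /eqP Ek]|/existsPn none] :=
      boolP [exists k : 'I_M, k.+1 * (size (polyn P)).-1 == N]%N; last first.
      by rewrite big1 // => k _; rewrite (negPf (none k)).
    rewrite (bigD1 k) //= Ek eqxx big1 => [|l nlk].
      rewrite addn0 lt0b; case: (nat_of_ord k) Ek => [|k'] Ek.
        by move: mN; rewrite -Ek mul1n ltnNge Pm.
      by rewrite geq_half_double -Ek -mul2n leq_mul2r orbT.
    apply/eqP; rewrite eqb0; apply: contraNneq nlk; rewrite -Ek => /eqP.
    by rewrite eqn_pmul2r ?eqSS // -subn1 subn_gt0.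
  rewrite -big_distrl /=; case: (leqP _ N./2) le1 => _ le1.
    by rewrite -[leqRHS]mul1n leq_mul.
  by move: le1 => /=; rewrite leqn0 => /eqP ->.
apply: (@leq_trans (\sum_(d < N./2) #|F| ^ d.+1)%N).
  pose dg (P : T) : 'I_N./2.+1 := inord (size (polyn P)).-1.
  have dgE (P : T) : ((size (polyn P)).-1 <= N./2)%N -> dg P = (size (polyn P)).-1 :> nat.
    by move=> PN; rewrite inordK.
  rewrite (partition_big dg predT) //= big_ord_recl /= big1 ?add0n; last first.
    move=> P /andP [/andP [pP PN] /eqP /(congr1 val)] /=.
    by rewrite dgE.
  apply: leq_sum => d _.
  apply: leq_trans (prime_poly_degree_sum (_ : 0 < d.+1 < M)%N); last first.
    by rewrite /= (leq_ltn_trans _ NM) // (leq_trans (ltn_ord d)) //; lia.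
  rewrite [X in (X <= _)%N]big_mkcond [X in (_ <= X)%N]big_mkcond.
  apply: leq_sum => P _; case: (prime_poly P) => //=.
  case: (leqP _ N./2) => //= PN; have [dP|//] := eqVneq (dg P) (lift ord0 d).
  have -> : ((size (polyn P)).-1 == d.+1)%N by rewrite -dgE // dP.
  by [].
elim: (N./2)%N => [|k IH]; first by rewrite big_ord0.
rewrite big_ord_recr /= (leq_trans (leq_add IH (leqnn _))) // expnS.
by rewrite mulnA -mulnDl leq_mul2r; apply/orP; right; rewrite mul2n -addnn leq_add2r.
Qed.

End PolyFactors.

Section SmoothPolyDensity.
Variables (R : realType) (F : finFieldType) (n m : nat).
Local Notation q := (#|F|%:R : R).

(** The exponential weights of the generating function in z/q of the smooth
    polynomials of degree at most n. *)
Definition poly_weight N : R := (prime_power_weight F n.+1 m N)%:R / q ^+ N.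

Lemma card_field_gt1 : 1 < q.
Proof. by rewrite ltr1n card_finNzRing_gt1. Qed.

Lemma card_field_gt0 : 0 < q.
Proof. exact: lt_trans ltr01 card_field_gt1. Qed.

Lemma poly_weight_ge0 N : 0 <= poly_weight N.
Proof. by rewrite divr_ge0 ?ler0n ?exprn_ge0 ?ler0n. Qed.

Lemma poly_weight1 N : (0 < N <= n)%N -> (N <= m)%N -> poly_weight N = 1.
Proof.
move=> Nn Nm; rewrite /poly_weight prime_power_weight_le_full // natrX divff //.
by rewrite expf_neq0 // gt_eqF // card_field_gt0.
Qed.

(** floor(N/2) - N = - ceil(N/2). *)
Lemma poly_weight_le N : (m < N <= n)%N -> poly_weight N <= 2 / q ^+ uphalf N.
Proof.
move=> mN; have q0 := card_field_gt0.
rewrite /poly_weight ler_pdivrMr ?exprn_gt0 //.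
rewrite -[X in _ * q ^+ X]odd_double_half -addnn addnA -uphalf_half exprD mulrA.
by rewrite divfK ?expf_neq0 ?gt_eqF // -natrX -natrM ler_nat prime_power_weight_le.
Qed.

Lemma prob_poly_smoothE : prob_poly_smooth R F n m = expc poly_weight n.
Proof.
have q0 := card_field_gt0.
rewrite /prob_poly_smooth /unif_prob /monic_polys card_monic_polys // natrX.
rewrite (_ : [set x in _ | _] = smooth_polys F n.+1 m n); last first.
  by apply/setP => f; rewrite !inE andbA.
apply: (@expc_uniq _ _ (fun i => #|smooth_polys F n.+1 m i|%:R / q ^+ i) n) => //.
  rewrite expr0 divr1 (_ : #|_| = 1%N) //.
  rewrite -[RHS](expn0 #|F|) -(@card_monic_polys F n.+1 0) //.
  apply: eq_card => f; rewrite !inE; case: (_ \is monic) => //=.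
  case: eqP => //= f1; apply/asboolP => g [g1 _].
  have [c c0 ->] := size_poly1P _ (introT eqP f1).
  by move/(dvdp_leq _); rewrite polyC_eq0 c0 size_polyC c0 leqNgt g1 => /(_ isT).
move=> i lt_in /=; rewrite mulrA -natrM smooth_polys_rec // natr_sum mulr_suml.
apply: eq_bigr => j _; rewrite subSS natrM /poly_weight.
have -> : q ^+ i.+1 = q ^+ j.+1 * q ^+ (i - j).
  by rewrite -exprD addSn subnKC // -ltnS.
by rewrite invfM mulrACA.
Qed.

Lemma prob_poly_smooth_le1 : prob_poly_smooth R F n m <= 1.
Proof.
rewrite /prob_poly_smooth /unif_prob ler_pdivrMr ?mul1r; last first.
  by rewrite /monic_polys card_monic_polys // natrX exprn_gt0 // card_field_gt0.
by rewrite ler_nat subset_leq_card //; apply/subsetP => f; rewrite inE => /andP [].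
Qed.

End SmoothPolyDensity.

(** * Comparison of the two densities *)

(** Weights that exceed those of [perm_density] by v multiply the exponential by
    the one of v; its constant term 1 accounts for the main term, and the others
    are weighted by p(n-k) / p(n) <= e x^k. *)
Lemma perturbed_density (R : realType) (v : nat -> R) n m :
  (0 < n)%N -> (0 < m)%N -> (forall j, 0 <= v j) ->
  let x : R := n%:R `^ m%:R^-1 in
  0 <= expc (fun j => v j + (j <= m)%:R) n / perm_density R m n - 1
    <= expR 1 * \sum_(k < n) expc (fun j => v j * x ^+ j) k.+1.
Proof.
move=> n0 m0 v0; set x := (n%:R `^ _) => /=.
have p0 := perm_density_gt0 R m0.
rewrite expcD -/(perm_density R m) big_ord_recl /= expc0 mul1r subn0.
rewrite mulrDl divff ?gt_eqF //.
rewrite addrAC subrr add0r; apply/andP; split.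
  rewrite divr_ge0 ?sumr_ge0 ?(ltW (p0 _)) // => k _.
  by rewrite mulr_ge0 ?expc_ge0 ?(ltW (p0 _)).
rewrite ler_pdivrMr // mulr_sumr mulr_suml; apply: ler_sum => k _.
rewrite expcZ mulrCA -!mulrA ler_wpM2l ?expc_ge0 // [leRHS]mulrA.
exact: perm_density_shift.
Qed.

(** * Estimates at the point n^(1/m) *)

Lemma leq_double_uphalf k : (k <= (uphalf k).*2)%N.
Proof.
by rewrite -{1}(odd_double_half k) uphalf_half doubleD leq_add2r; case: odd.
Qed.

(** The parity correction a makes m + 1 + a the even number 2 ceil((m+1)/2). *)
Lemma uphalf_parity (R : realType) m :
  2 * (uphalf m.+1)%:R = m%:R + 1 + (if odd m then 0 else 1) :> R.
Proof.
rewrite -natrM mul2n -[in m%:R](odd_double_half m) /= doubleS.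
case: (odd m) => /=; rewrite ?add0n ?add1n -!natr1; ring.
Qed.

Lemma ceil_half_succ (R : realType) m :
  Num.ceil ((m%:R + 1) / 2 : R) = (uphalf m.+1)%:Z.
Proof.
move: (uphalf m.+1) (uphalf_parity R m) => j jE.
apply: ceil_def; rewrite rmorphB /= -!pmulrn.
by apply/andP; split; move: jE; case: ifP => _; lra.
Qed.

(** Each exponent occurs at most twice. The sum telescopes because
    ceil((i+3)/2) = ceil((i+1)/2) + 1. *)
Lemma sum_uphalf_geometric (R : realFieldType) (t : R) m n :
  0 <= t <= 1 -> (1 - t) * \sum_(m <= i < n) t ^+ uphalf i.+1 <= 2 * t ^+ uphalf m.+1.
Proof.
case/andP => t0 t1.
have [le_mn|lt_nm] := leqP m n; last first.
  by rewrite big_geq ?(ltnW lt_nm) // mulr0 mulr_ge0 ?exprn_ge0.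
pose T i := t ^+ uphalf i.+1 + t ^+ uphalf i.+2.
have T0 i : 0 <= T i by rewrite addr_ge0 ?exprn_ge0.
have -> : (1 - t) * \sum_(m <= i < n) t ^+ uphalf i.+1 = T m - T n.
  rewrite -[RHS]opprB -(telescope_sumr T le_mn) -sumrN mulr_sumr.
  apply: eq_bigr => i _; rewrite /T [uphalf i.+3]/= exprS; ring.
apply: (@le_trans _ _ (T m)); first by rewrite gerBl.
rewrite mulr_natl mulr2n lerD2l ler_wiXn2l //.
lia.
Qed.

Lemma self_bound (R : realFieldType) (S H : R) :
  0 <= H -> S <= 1 / 2 -> H <= S * (1 + H) -> H <= 2 * S.
Proof.
move=> H0 S2 le_H; have : S * H <= 1 / 2 * H by rewrite ler_wpM2r.
by move: le_H; rewrite mulrDr mulr1; lra.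
Qed.

Section SaddlePoint.
Variables (R : realType) (eps q : R) (n m : nat).
Hypotheses (eps0 : 0 < eps) (q2 : 2 <= q) (n2 : (2 <= n)%N) (m0 : (0 < m)%N).
Hypothesis lower : (2 + eps) * logb q n%:R <= m%:R.

Let t : R := (n%:R `^ m%:R^-1) ^+ 2 / q.

(** 2^(-eps/(2+eps)), an upper bound for t = x^2 / q that depends on eps
    alone. *)
Definition decay : R := expR (- (eps / (2 + eps) * ln 2)).

Lemma decay_lt1 : decay < 1.
Proof.
by rewrite expR_lt1 oppr_lt0 mulr_gt0 ?divr_gt0 ?addr_gt0 ?ln_gt0 ?ltr1n.
Qed.

Let m0R : 0 < m%:R :> R. Proof. by rewrite ltr0n. Qed.
Let n0R : 0 < n%:R :> R. Proof. by rewrite ltr0n ltnW. Qed.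
Let q0 : 0 < q. Proof. by apply: lt_le_trans q2. Qed.
Let lnq : ln 2 <= ln q. Proof. by rewrite ler_ln ?posrE. Qed.
Let lnq0 : 0 < ln q. Proof. by apply: lt_le_trans lnq; rewrite ln_gt0 // ltr1n. Qed.

Let lower' : (2 + eps) * ln n%:R <= m%:R * ln q.
Proof. by move: lower; rewrite /logb mulrA ler_pdivrMr. Qed.

Let t_ge0 : 0 <= t. Proof. by rewrite divr_ge0 ?exprn_ge0 ?powR_ge0 ?ltW. Qed.

Let tE : t = expR (2 * (ln n%:R / m%:R) - ln q).
Proof.
rewrite /t expRB lnK ?posrE // expRM_natl; congr (_ ^+ 2 / _).
by rewrite /powR gt_eqF // mulrC.
Qed.

(** The lower bound on m says that x^(2+eps) <= q, so that t is at most
    q^(2/(2+eps) - 1). *)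
Lemma saddle_le_decay : t <= decay.
Proof.
rewrite tE ler_expR.
have e2 : 0 < 2 + eps by rewrite addr_gt0.
have h : ln n%:R / m%:R <= ln q / (2 + eps).
  by rewrite ler_pdivrMr // mulrAC ler_pdivlMr // mulrC (mulrC _ m%:R).
have : eps / (2 + eps) * ln 2 <= eps / (2 + eps) * ln q.
  by rewrite ler_wpM2l // divr_ge0 // ltW.
have -> : eps / (2 + eps) * ln q = ln q - 2 * (ln q / (2 + eps)).
  by field; rewrite gt_eqF.
by move: h; lra.
Qed.

(** From x^(2+eps) <= q one gets t <= x^(-eps), and 2 ceil((m+1)/2) >= m. *)
Lemma saddle_exp_le : t ^+ uphalf m.+1 <= n%:R `^ (- (eps / 2)).
Proof.
rewrite tE -expRM_natl /powR gt_eqF // ler_expR.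
have h : 2 * (ln n%:R / m%:R) - ln q <= - (eps * (ln n%:R / m%:R)).
  have : (2 + eps) * (ln n%:R / m%:R) <= ln q.
    by rewrite mulrA ler_pdivrMr // (mulrC (ln q)).
  by lra.
apply: le_trans (ler_wpM2l (ler0n _ _) h) _.
have l0 : 0 <= ln n%:R / m%:R :> R by rewrite divr_ge0 ?(ltW m0R) // ln_ge0 // ler1n ltnW.
have half : m%:R <= 2 * (uphalf m.+1)%:R :> R
  by rewrite -natrM ler_nat mul2n /= doubleS leqW // -leq_half_double.
rewrite mulrN mulNr lerN2.
have -> : eps / 2 * ln n%:R = (eps / 2 * (ln n%:R / m%:R)) * m%:R.
  by field; rewrite gt_eqF.
have c0 : 0 <= eps / 2 * (ln n%:R / m%:R) by rewrite mulr_ge0 // ltW // divr_gt0.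
by have := ler_wpM2l c0 half; lra.
Qed.

(** As x >= 1 and j <= 2 ceil(j/2), the term v_j x^j / j is at most
    (2/m) t^(ceil(j/2)), which leaves a geometric sum. *)
Lemma saddle_sum_le (v : nat -> R) :
  (forall j, v j <= if (m < j <= n)%N then 2 / q ^+ uphalf j else 0) ->
  \sum_(i < n) v i.+1 * (n%:R `^ m%:R^-1) ^+ i.+1 / i.+1%:R
    <= 4 / (1 - decay) * (t ^+ uphalf m.+1 / m%:R).
Proof.
move=> v_le; set x := n%:R `^ _.
have x1 : 1 <= x.
  rewrite -[leLHS](powRr0 (n%:R : R)); apply: ler_powR; first by rewrite ler1n ltnW.
  by rewrite invr_ge0 ltW.
have x0 : 0 <= x := le_trans ler01 x1.
have step i : v i.+1 * x ^+ i.+1 / i.+1%:R <=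
    if (m <= i)%N then 2 / m%:R * t ^+ uphalf i.+1 else 0.
  have := v_le i.+1; rewrite ltnS; have [le_mi|lt_im] /= := leqP m i; last first.
    by move=> vi; rewrite mulr_le0_ge0 ?invr_ge0 // mulr_le0_ge0 ?exprn_ge0.
  move=> vi; apply: (@le_trans _ _ (2 * t ^+ uphalf i.+1 / i.+1%:R)).
    rewrite ler_wpM2r ?invr_ge0 //.
    have vle : v i.+1 <= 2 / q ^+ uphalf i.+1.
      apply: le_trans vi _; case: ifP => // _.
      by rewrite divr_ge0 ?exprn_ge0 // ltW.
    apply: le_trans (ler_wpM2r _ vle) _; first by rewrite exprn_ge0.
    rewrite /t -/x expr_div_n -exprM mulrAC mulrA.
    rewrite ler_wpM2r ?invr_ge0 ?exprn_ge0 ?(ltW q0) //.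
    by rewrite ler_wpM2l // ler_weXn2l // mul2n leq_double_uphalf.
  rewrite [leRHS]mulrAC ler_wpM2l ?mulr_ge0 ?exprn_ge0 //.
  by rewrite lef_pV2 ?posrE ?ltr0n // ler_nat leqW.
apply: le_trans (ler_sum _ (fun (i : 'I_n) _ => step i)) _.
rewrite -big_mkcond -mulr_sumr.
have -> : \sum_(i < n | (m <= i)%N) t ^+ uphalf i.+1 =
          \sum_(m <= i < n) t ^+ uphalf i.+1.
  by rewrite big_geq_mkord.
have t01 : 0 <= t <= 1 by rewrite t_ge0 (le_trans saddle_le_decay) // ltW // decay_lt1.
have geo := sum_uphalf_geometric m n t01.
set G := \sum_(m <= i < n) _ in geo *.
have G0 : 0 <= G by apply: sumr_ge0 => i _; rewrite exprn_ge0.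
have {}geo : (1 - decay) * G <= 2 * t ^+ uphalf m.+1.
  by apply: le_trans geo; rewrite ler_wpM2r // lerD2l lerN2 saddle_le_decay.
have d0 : 0 < 1 - decay by rewrite subr_gt0 decay_lt1.
rewrite mulrACA -invfM mulrC ler_pdivlMr ?mulr_gt0 //.
have -> : G * (2 / m%:R) * ((1 - decay) * m%:R) = 2 * ((1 - decay) * G).
  by field; rewrite gt_eqF.
by lra.
Qed.

End SaddlePoint.

(** The error term of the theorem, since 2 ceil((m+1)/2) = m + 1 + a and
    x^m = n. *)
Lemma saddle_powE (R : realType) (q : R) n m : (0 < n)%N -> (0 < m)%N ->
  let a : R := if odd m then 0 else 1 in
  ((n%:R `^ m%:R^-1) ^+ 2 / q) ^+ uphalf m.+1 / m%:R =
  n%:R / m%:R * (n%:R `^ ((1 + a) / m%:R)) / q ^+ uphalf m.+1.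
Proof.
move=> n0 m0 a.
have n0R : 0 < n%:R :> R by rewrite ltr0n.
have m0R : 0 < m%:R :> R by rewrite ltr0n.
rewrite expr_div_n -exprM mulrAC; congr (_ / _).
rewrite [RHS]mulrAC; congr (_ / _).
rewrite -powR_mulrn ?powR_ge0 // -powRrM natrM uphalf_parity -/a.
have -> : m%:R^-1 * (m%:R + 1 + a) = 1 + (1 + a) / m%:R by field; rewrite gt_eqF.
rewrite powRD ?powRr1 ?(ltW n0R) //.
by rewrite (gt_eqF n0R) implybT.
Qed.

(** * The relative error *)

Theorem theorem1p2 (R : realType) (eps : R) (heps : 0 < eps) :
  exists2 C : R, 0 < C &
  forall (q : nat) (F : finFieldType), #|F| = q ->
  forall n m : nat, (2 <= n)%N -> (1 <= m <= n)%N ->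
  m%:R <= 8 * ln (n%:R : R) ->
  (2 + eps) * logb (q%:R : R) n%:R <= m%:R ->
  let u : R := n%:R / m%:R in
  let a : R := if odd m then 0 else 1 in
  `| prob_poly_smooth R F n m / prob_perm_smooth R n m - 1 |
    <= C * (u * (n%:R `^ ((1 + a) / m%:R)) / q%:R ^ Num.ceil ((m%:R + 1) / 2 : R)).
Proof.
pose K : R := 4 / (1 - decay eps).
have K0 : 0 < K by rewrite divr_gt0 // subr_gt0 decay_lt1.
(* With S the sum bounded in [saddle_sum_le], S > 1/2 forces
   1 <= 2 K n^(-eps/2), that is n <= N0. *)
pose N0 := Num.truncn (expR (2 * ln (2 * K) / eps)).
exists (2 * K * (expR 1 + N0`!%:R)).
  apply: mulr_gt0; first exact: mulr_gt0.
  by rewrite ltr_wpDr ?expR_gt0.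
move=> q F Fq n m n2 /andP [m0 le_mn] _ lower /=.
have n0 : (0 < n)%N := ltnW n2.
have m0R : 0 < m%:R :> R by rewrite ltr0n.
have q2 : 2 <= q%:R :> R by rewrite -Fq ler_nat card_finNzRing_gt1.
have q0 : 0 < q%:R :> R by apply: lt_le_trans q2.
have le_tn := saddle_exp_le heps q2 n2 m0 lower.
set x : R := n%:R `^ m%:R^-1 in le_tn; set t : R := x ^+ 2 / q%:R in le_tn.
have t0 : 0 <= t by rewrite divr_ge0 ?exprn_ge0 ?powR_ge0 // ltW.
rewrite ceil_half_succ -exprnP -saddle_powE // -/x -/t.
set B := t ^+ _ / _.
have B0 : 0 <= B by rewrite divr_ge0 ?exprn_ge0 // ltW.
(* Cutting the weights at n makes v nonnegative and bounded everywhere without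
   changing the coefficients up to n. *)
pose v j : R := if (m < j <= n)%N then poly_weight R F n m j else 0.
have v0 j : 0 <= v j by rewrite /v; case: ifP => // _; exact: poly_weight_ge0.
have polyE : prob_poly_smooth R F n m = expc (fun j => v j + (j <= m)%:R) n.
  rewrite prob_poly_smoothE; apply: eq_expc => j jn; rewrite /v.
  case: (leqP j m) => jm; first by rewrite /= add0r poly_weight1.
  by case/andP: jn => _ ->; rewrite addr0.
have := perturbed_density n0 m0 v0; rewrite -polyE -/x => /andP [ge0 le_eH].
rewrite prob_perm_smoothE // ger0_norm //.
set H := \sum_(k < n) _ in le_eH.
have vx0 j : 0 <= v j * x ^+ j by rewrite mulr_ge0 ?exprn_ge0 // powR_ge0.
have H0 : 0 <= H by apply: sumr_ge0 => k _; exact: expc_ge0.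
have /= := sum_expc_le n vx0; rewrite -/H.
set S := \sum_(i < n) _ => le_HS.
have le_SK : S <= K * B.
  apply: saddle_sum_le => // j; rewrite /v; case: ifP => // mjn.
  by rewrite -Fq poly_weight_le.
have [S_small|S_big] := leP S (1 / 2).
  have H2 := self_bound H0 S_small le_HS.
  apply: le_trans le_eH _.
  have e0 := expR_gt0 (1 : R).
  apply: le_trans (ler_wpM2l (ltW e0) (le_trans H2 (ler_wpM2l _ le_SK))) _ => //.
  have -> : expR 1 * (2 * (K * B)) = 2 * K * expR 1 * B by ring.
  rewrite ler_wpM2r // ler_wpM2l ?lerDl ?ler0n //.
  by rewrite mulr_ge0 // ltW.
have K20 : 0 < 2 * K by exact: mulr_gt0.
have KB : 1 <= 2 * K * B by move: S_big le_SK; lra.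
have nN0 : (n <= N0)%N.
  rewrite /N0 truncn_ge_nat ?expR_ge0 //.
  have n0R : 0 < n%:R :> R by rewrite ltr0n.
  rewrite -ler_ln ?posrE ?expR_gt0 // expRK ler_pdivlMr //.
  have : 1 <= 2 * K * n%:R `^ (- (eps / 2)).
    apply: le_trans KB _; rewrite (ler_wpM2l (ltW K20)) //.
    apply: le_trans le_tn; rewrite /B ler_pdivrMr // ler_peMr ?exprn_ge0 // ler1n //.
  rewrite -ler_ln ?posrE ?(mulr_gt0 K20) ?powR_gt0 // ln1 lnM ?posrE ?powR_gt0 //.
  by rewrite ln_powR; lra.
have p0 := perm_density_gt0 R m0 n.
apply: (@le_trans _ _ N0`!%:R).
  apply: (@le_trans _ _ (perm_density R m n)^-1).
    rewrite lerBlDr (le_trans _ (_ : (perm_density R m n)^-1 <= _)) ?lerDl //.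
    by rewrite ler_pdivrMr // mulVf ?gt_eqF // prob_poly_smooth_le1.
  apply: (@le_trans _ _ n`!%:R); last by rewrite ler_nat leq_fact.
  by rewrite -[leRHS]invrK lef_pV2 ?posrE ?invr_gt0 ?ltr0n ?fact_gt0 // perm_density_ge_fact.
have -> : 2 * K * (expR 1 + N0`!%:R) * B = 2 * K * B * (expR 1 + N0`!%:R) by ring.
apply: le_trans (ler_peMl _ KB); last by rewrite addr_ge0 ?expR_ge0.
by rewrite lerDr expR_ge0.
Qed.
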